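(* Let $P_1$ and $P_2$ be real constant coefficient ordinary differential operators of orders $n_1$ and $n_2$, and let $\Sigma(t_1,t_2)=\sigma_1(t_1)\otimes\sigma_2(t_2)$ be the associated surface in $\mathbb{R}^{n_1n_2}$. If all the roots of the characteristic polynomials $\mathcal{P}_1$ and $\mathcal{P}_2$ are simple, if the real roots are dominant, and if $n_1=n_2=2$, then $K[\Sigma]=0$.
   Context: For $i=1,2$, $P_i$ is a real constant coefficient ordinary differential operator (with leading coefficient $1$) of order $n_i$ with characteristic polynomial $\mathcal{P}_i$. ''The real roots are dominant'' means that, for each $i$, $\mathcal{P}_i$ has a real positive root whose real part is strictly larger than that of every other root, and a real negative root whose real part is strictly smaller than that of every other root. Hence, when $n_1=n_2=2$, the roots of $\mathcal{P}_1$ are real numbers $r_1>0>r_2$ and the roots of $\mathcal{P}_2$ are real numbers $s_1>0>s_2$. In this case the associated curves are $\sigma_1(t_1)=(e^{r_1t_1},e^{r_2t_1})$ and $\sigma_2(t_2)=(e^{s_1t_2},e^{s_2t_2})$, and $\Sigma:\mathbb{R}^2\to\mathbb{R}^4$ is $\Sigma(t_1,t_2)=\sigma_1(t_1)\otimes\sigma_2(t_2)$, i.e. its four coordinates are $e^{r_it_1+s_jt_2}$ for $i,j\in\{1,2\}$; $\mathbb{R}^4$ carries the standard Euclidean inner product. The total Gauss curvature is $K[\Sigma]=\int_{\mathbb{R}^2}K\,g\,dt_1dt_2$, where $g_{ij}=(\partial_{t_i}\Sigma,\partial_{t_j}\Sigma)$, $g=\sqrt{g_{11}g_{22}-g_{12}^2}$,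 and $K$ is the Gauss curvature of the induced metric; the integral converges absolutely under the hypotheses. *)

(* Defs.v *)
From HB Require Import structures.
From mathcomp Require Import all_boot all_order all_algebra.
From mathcomp.real_closed Require Import complex.
From mathcomp Require Import all_classical all_reals all_analysis.
Set Implicit Arguments.
Unset Strict Implicit.
Unset Printing Implicit Defensive.
Import Order.TTheory GRing.Theory Num.Theory.
Import numFieldNormedType.Exports.
Local Open Scope ring_scope.
Local Open Scope complex_scope.

Section Operators.
Variable R : realType.

(* The operator P = d^n/dt^n + c_(n-1) d^(n-1)/dt^(n-1) + ... + c_0 of order n
   is represented by its lower-order coefficients c. *)
Definition char_polynomial (n : nat) (c : 'rV[R]_n) : {poly R} :=
  'X^n + \sum_(j < n) c 0 j *: 'X^j.

Definition complex_char_polynomial (n : nat) (c : 'rV[R]_n) : {poly R[i]} :=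
  map_poly (real_complex R) (char_polynomial c).

Definition all_roots_simple (n : nat) (c : 'rV[R]_n) : Prop :=
  forall z : R[i], root (complex_char_polynomial c) z ->
    mup z (complex_char_polynomial c) = 1%N.

Definition real_roots_dominant (n : nat) (c : 'rV[R]_n) : Prop :=
  (exists r : R, [/\ 0 < r, root (char_polynomial c) r &
     forall z : R[i], root (complex_char_polynomial c) z -> z != r%:C ->
       complex.Re z < r]) /\
  (exists r : R, [/\ r < 0, root (char_polynomial c) r &
     forall z : R[i], root (complex_char_polynomial c) z -> z != r%:C ->
       r < complex.Re z]).

Definition root_enumeration (n : nat) (c : 'rV[R]_n) (z : n.-tuple R[i]) :
    Prop :=
  complex_char_polynomial c = \prod_(x <- z) ('X - x%:P).

(* The curve whose coordinates are the standard real basis of ker P: for a root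
   z = a + ib, the functions t^k e^(at) cos(bt) if b >= 0 and
   t^k e^(at) sin(-bt) if b < 0, where k counts the earlier occurrences of z in
   the enumeration, so k ranges over the integers below its multiplicity.
   Each conjugate pair contributes one cosine and one sine; a simple real root
   r contributes e^(rt). *)
Definition associated_curve (n : nat) (z : n.-tuple R[i]) (t : R) : 'rV[R]_n :=
  \row_(i < n)
    let x := tnth z i in
    t ^+ count_mem x (take i z) * expR (complex.Re x * t) *
    (if 0 <= complex.Im x then cos (complex.Im x * t)
     else sin (- complex.Im x * t)).

(* mxvec identifies R^n1 (x) R^n2 with R^(n1 n2). *)
Definition associated_surface (n1 n2 : nat) (z1 : n1.-tuple R[i])
    (z2 : n2.-tuple R[i]) (t : R * R) : 'rV[R]_(n1 * n2) :=
  mxvec ((associated_curve z1 t.1)^T *m associated_curve z2 t.2).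

End Operators.

Section Curvature.
Variable R : realType.

Definition inner (n : nat) (u v : 'rV[R]_n) : R := (u *m v^T) 0 0.

Definition partial (V : normedModType R) (i : 'I_2) (f : R * R -> V)
    (t : R * R) : V :=
  if i == 0 then (fun s : R => f (s, t.2))^`()%classic t.1
  else (fun s : R => f (t.1, s))^`()%classic t.2.

Definition induced_metric (n : nat) (S : R * R -> 'rV[R]_n) (t : R * R) :
    'M[R]_2 :=
  \matrix_(i, j) inner (partial i S t) (partial j S t).

Definition area_density (g : R * R -> 'M[R]_2) (t : R * R) : R :=
  Num.sqrt (g t 0 0 * g t 1 1 - g t 0 1 ^+ 2).

(* Gamma^k_ij *)
Definition christoffel (g : R * R -> 'M[R]_2) (k i j : 'I_2) (t : R * R) : R :=
  2^-1 * \sum_(l < 2) invmx (g t) k l *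
    (partial i (fun s => g s j l : R^o) t + partial j (fun s => g s i l : R^o) t
     - partial l (fun s => g s i j : R^o) t).

(* The component R^l_kij defined by R(d_i, d_j) d_k = sum_l R^l_kij d_l, with
   R(X, Y) = [D_X, D_Y] - D_[X, Y]. *)
Definition riemann (g : R * R -> 'M[R]_2) (l k i j : 'I_2) (t : R * R) : R :=
  partial i (christoffel g l j k : R * R -> R^o) t
  - partial j (christoffel g l i k : R * R -> R^o) t
  + \sum_(m < 2) (christoffel g l i m t * christoffel g m j k t
                  - christoffel g l j m t * christoffel g m i k t).

(* K = <R(d_1, d_2) d_2, d_1> / det g; equal to 1 on the unit sphere. *)
Definition gauss_curvature (g : R * R -> 'M[R]_2) (t : R * R) : R :=
  (\sum_(l < 2) g t 0 l * riemann g l 1 0 1 t) / \det (g t).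

Definition curvature_density (n : nat) (S : R * R -> 'rV[R]_n) (t : R * R) : R :=
  gauss_curvature (induced_metric S) t * area_density (induced_metric S) t.

Definition plane_measure := (@lebesgue_measure R \x @lebesgue_measure R)%E.

Definition total_gauss_curvature (n : nat) (S : R * R -> 'rV[R]_n) : \bar R :=
  (\int[plane_measure]_(t in [set: R * R]) (curvature_density S t)%:E)%E.

End Curvature.
Arguments plane_measure R : clear implicits.

(* Main.v *)
(* For s = sigma_1 let p_0 = <s, s>, p_1 = <s, s'>, p_2 = <s', s'>, and let q_j
   be the same functions for sigma_2.  The induced metric has the entries
   p_2 q_0, p_1 q_1, p_0 q_2, and the differential equation of sigma_i is a
   linear system for the p_j and for the q_j.  This gives
   K (det g)^2 = D E (k l p_0 q_0 - p_2 q_2), where D = p_2 p_0 - p_1^2,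
   E = q_2 q_0 - q_1^2, and k, l are the products of the roots.  If the roots of
   P_1 are a > 0 > -b and x = e^((a + b) u), then up to a common factor
   p_0, p_1, p_2 are x + 1/x, a x - b/x, a^2 x + b^2/x, and the product of the
   roots is -a b.  The reflection x -> b/(a x) exchanges a b p_0 with p_2 and
   changes the sign of p_1, so reflecting both variables changes the sign of
   K sqrt(det g).  These reflections preserve Lebesgue measure, hence the
   integral vanishes.  It converges absolutely because the integrand is
   O(((x + 1/x) (y + 1/y))^(-1/2)). *)
Require Import Defs.
From HB Require Import structures.
From mathcomp Require Import all_boot all_order all_algebra.
From mathcomp.real_closed Require Import complex.
From mathcomp Require Import all_classical all_reals all_analysis.
From mathcomp Require Import measurable_realfun ring lra.
Set Implicit Arguments.
Unset Strict Implicit.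
Unset Printing Implicit Defensive.
Import Order.TTheory GRing.Theory Num.Theory.
Import numFieldNormedType.Exports.
Local Open Scope ring_scope.

(** * Partial derivatives and 2 by 2 matrices *)

Lemma lift_ord0_I1 (i : 'I_1) : lift ord0 i = 1 :> 'I_2.
Proof. by rewrite ord1; apply/val_inj. Qed.

Section Partials.
Variable R : realType.

Lemma partial0_eq (f : R * R -> R) (t : R * R) (d : R) :
  is_derive t.1 (1 : R) (fun s => f (s, t.2)) d ->
  partial 0 (f : R * R -> R^o) t = d.
Proof.
move=> fd.
have <- : (fun s => f (s, t.2))^`()%classic t.1 = d.
  by rewrite derive1E; exact: derive_val.
by rewrite /partial eqxx.
Qed.

Lemma partial1_eq (f : R * R -> R) (t : R * R) (d : R) :
  is_derive t.2 (1 : R) (fun s => f (t.1, s)) d ->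
  partial 1 (f : R * R -> R^o) t = d.
Proof.
move=> fd.
have <- : (fun s => f (t.1, s))^`()%classic t.2 = d.
  by rewrite derive1E; exact: derive_val.
by rewrite /partial.
Qed.

Lemma is_derive_mulr (f : R -> R) (c x d : R) :
  is_derive x 1 f d -> is_derive x 1 (fun s => f s * c) (d * c).
Proof.
move=> fd; rewrite (_ : (fun s => f s * c) = f * cst c)//; apply: is_derive_eq.
by rewrite scaler0 add0r [RHS]mulrC.
Qed.

Lemma is_derive_mull (f : R -> R) (c x d : R) :
  is_derive x 1 f d -> is_derive x 1 (fun s => c * f s) (c * d).
Proof.
move=> fd; under eq_fun do rewrite mulrC.
by rewrite mulrC; exact: is_derive_mulr.
Qed.

Lemma is_derive_div (f h : R -> R) (x df dh : R) :
  is_derive x 1 f df -> is_derive x 1 h dh -> h x != 0 ->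
  is_derive x 1 (fun s => f s / h s) ((df * h x - f x * dh) / h x ^+ 2).
Proof.
move=> fd hd hx; have hVd := is_deriveV hx hd.
rewrite (_ : (fun s => f s / h s) = f * (fun s => (h s)^-1))//.
apply: is_derive_eq; rewrite /GRing.scale /=; field; exact: hx.
Qed.

Lemma invmx2E (A : 'M[R]_2) (d : R) :
  d = A 0 0 * A 1 1 - A 0 1 * A 1 0 -> d != 0 ->
  [/\ invmx A 0 0 = A 1 1 / d, invmx A 0 1 = - A 0 1 / d,
      invmx A 1 0 = - A 1 0 / d & invmx A 1 1 = A 0 0 / d].
Proof.
move=> dE d0.
pose B : 'M[R]_2 := \matrix_(i, j)
  if i == 0 then (if j == 0 then A 1 1 / d else - A 0 1 / d)
  else (if j == 0 then - A 1 0 / d else A 0 0 / d).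
have AB : A *m B = 1%:M.
  apply/matrixP => i j; rewrite !mxE !big_ord_recl big_ord0 lift_ord0_I1.
  rewrite !mxE /=; case: (unliftP 0 i) => [?|] ->;
    case: (unliftP 0 j) => [?|] ->;
    by rewrite ?lift_ord0_I1 /= ?eqxx /=; field: dE.
have [Au _] := mulmx1_unit AB.
have -> : invmx A = B by rewrite -[B](mulKmx Au) AB mulmx1.
by rewrite !mxE.
Qed.

Lemma det_mx2 (A : 'M[R]_2) : \det A = A 0 0 * A 1 1 - A 0 1 * A 1 0.
Proof.
rewrite (expand_det_row _ 0) !big_ord_recl big_ord0 /cofactor !det_mx11 !mxE /=.
rewrite lift_ord0_I1; have -> : lift 1 0 = 0 :> 'I_2 by apply/val_inj.
by rewrite /=; ring.
Qed.

End Partials.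

(** * Gauss curvature of a metric whose entries separate the variables *)

Section CurvatureOfProductMetric.
Variable R : realType.

Lemma is_derive_fadd (f h : R -> R) (x df dh : R) :
  is_derive x 1 f df -> is_derive x 1 h dh ->
  is_derive x 1 (fun s => f s + h s) (df + dh).
Proof.
by move=> fd hd; rewrite (_ : (fun s => f s + h s) = f + h)//;
  apply: is_derive_eq.
Qed.

Lemma is_derive_fsub (f h : R -> R) (x df dh : R) :
  is_derive x 1 f df -> is_derive x 1 h dh ->
  is_derive x 1 (fun s => f s - h s) (df - dh).
Proof.
by move=> fd hd; rewrite (_ : (fun s => f s - h s) = f - h)//;
  apply: is_derive_eq.
Qed.

Lemma is_derive_fmul (f h : R -> R) (x df dh : R) :
  is_derive x 1 f df -> is_derive x 1 h dh ->
  is_derive x 1 (fun s => f s * h s) (df * h x + f x * dh).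
Proof.
move=> fd hd; rewrite (_ : (fun s => f s * h s) = f * h)//; apply: is_derive_eq.
by rewrite addrC [_ *: df]mulrC.
Qed.

Lemma is_derive_fsqr (f : R -> R) (x df : R) :
  is_derive x 1 f df -> is_derive x 1 (fun s => f s ^+ 2) (2 * f x * df).
Proof.
move=> fd; under eq_fun do rewrite expr2.
by apply: (is_derive_eq (is_derive_fmul fd fd)); ring.
Qed.

Lemma is_derive_const (c x : R) : is_derive x 1 (fun=> c : R) 0.
Proof. exact: is_derive_cst. Qed.

(* The equations satisfied by a = <s, s>, a0 = <s, s'>, a1 = <s', s'> when
   s'' = m s' - k s. *)
Definition gram_system (m k : R) (a a0 a1 : R -> R) : Prop :=
  forall x : R, [/\ is_derive x 1 a (2 * a0 x),
    is_derive x 1 a0 (a1 x + m * a0 x - k * a x) &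
    is_derive x 1 a1 (2 * (m * a1 x - k * a0 x))].

(** The first fundamental form of s (x) r, with tangent vectors s' (x) r and s (x) r', when [a],
    [a0], [a1] are the Gram functions of s and [b], [b0], [b1] those of r. *)
Definition product_metric (a a0 a1 b b0 b1 : R -> R) (t : R * R) : 'M[R]_2 :=
  \matrix_(i, j)
    if i == 0 then (if j == 0 then a1 t.1 * b t.2 else a0 t.1 * b0 t.2)
    else (if j == 0 then a0 t.1 * b0 t.2 else a t.1 * b1 t.2).

Variables (a a0 a1 b b0 b1 : R -> R) (m k n l : R).
Hypothesis da : gram_system m k a a0 a1.
Hypothesis db : gram_system n l b b0 b1.

Let g := product_metric a a0 a1 b b0 b1.
Let dt (t : R * R) :=
  a1 t.1 * b t.2 * (a t.1 * b1 t.2) - (a0 t.1 * b0 t.2) ^+ 2.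
Hypothesis dt0 : forall t, dt t != 0.

Lemma partial0_sep (f h : R -> R) (d : R) (t : R * R) :
  is_derive t.1 1 f d -> partial 0 (fun s => f s.1 * h s.2 : R^o) t = d * h t.2.
Proof.
move=> fd; apply: (@partial0_eq _ (fun s => f s.1 * h s.2)) => /=.
exact: is_derive_mulr.
Qed.

Lemma partial1_sep (f h : R -> R) (d : R) (t : R * R) :
  is_derive t.2 1 h d -> partial 1 (fun s => f s.1 * h s.2 : R^o) t = f t.1 * d.
Proof.
move=> fd; apply: (@partial1_eq _ (fun s => f s.1 * h s.2)) => /=.
exact: is_derive_mull.
Qed.

(** The linear systems express the partial derivatives of the metric through the same six functions,
    so every symbol is rational in them with denominator [dt]. D and E are the Gram determinants of
    the pairs (s, s') and (r, r'). *)
Lemma christoffel_product (t : R * R) :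
  let A := a t.1 in let A0 := a0 t.1 in let A1 := a1 t.1 in
  let B := b t.2 in let B0 := b0 t.2 in let B1 := b1 t.2 in
  let D := A1 * A - A0 ^+ 2 in let E := B1 * B - B0 ^+ 2 in
  [/\ christoffel g 0 0 0 t = m - k * (A * A0 * E / dt t),
      christoffel g 1 0 0 t = - k * (B * B0 * D / dt t),
      christoffel g 0 0 1 t = B0 * B1 * D / dt t &
      christoffel g 1 0 1 t = A0 * A1 * E / dt t] /\
  [/\ christoffel g 0 1 0 t = B0 * B1 * D / dt t,
      christoffel g 1 1 0 t = A0 * A1 * E / dt t,
      christoffel g 0 1 1 t = - l * (A * A0 * E / dt t) &
      christoffel g 1 1 1 t = n - l * (B * B0 * D / dt t)].
Proof.
have g00 : (fun s => g s 0 0 : R^o) = (fun s => a1 s.1 * b s.2 : R^o).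
  by apply/funext => s; rewrite mxE.
have g01 : (fun s => g s 0 1 : R^o) = (fun s => a0 s.1 * b0 s.2 : R^o).
  by apply/funext => s; rewrite mxE.
have g10 : (fun s => g s 1 0 : R^o) = (fun s => a0 s.1 * b0 s.2 : R^o).
  by apply/funext => s; rewrite mxE.
have g11 : (fun s => g s 1 1 : R^o) = (fun s => a s.1 * b1 s.2 : R^o).
  by apply/funext => s; rewrite mxE.
have dE : dt t = g t 0 0 * g t 1 1 - g t 0 1 * g t 1 0.
  by rewrite !mxE /= -expr2.
have [i00 i01 i10 i11] := invmx2E dE (dt0 t).
have [pa pa0 pa1] := da t.1; have [pb pb0 pb1] := db t.2.
have := dt0 t.
rewrite /christoffel !big_ord_recl !big_ord0 !lift_ord0_I1.
rewrite i00 i01 i10 i11 g00 g01 g10 g11.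
rewrite !(partial0_sep _ pa) !(partial0_sep _ pa0) !(partial0_sep _ pa1).
rewrite !(partial1_sep _ pb) !(partial1_sep _ pb0) !(partial1_sep _ pb1).
rewrite !mxE /= /dt.
move=> dn0; split; split; field; exact: dn0.
Qed.

(** The curvature differentiates only the symbols Gamma^l_11 and Gamma^l_01. The linear systems
    remove these derivatives as well, and [m] and [n] cancel in the resulting rational identity. *)
Lemma gauss_curvature_product (t : R * R) :
  let A := a t.1 in let A0 := a0 t.1 in let A1 := a1 t.1 in
  let B := b t.2 in let B0 := b0 t.2 in let B1 := b1 t.2 in
  let D := A1 * A - A0 ^+ 2 in let E := B1 * B - B0 ^+ 2 in
  gauss_curvature g t = D * E * (k * l * A * B - A1 * B1) / dt t ^+ 2.
Proof.
have C t' := christoffel_product t'.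
(* The quotients occurring in the symbols, as functions of the point, because they are
   differentiated below. *)
pose al (t : R * R) :=
  a t.1 * a0 t.1 * (b1 t.2 * b t.2 - b0 t.2 ^+ 2) / dt t.
pose be (t : R * R) :=
  b t.2 * b0 t.2 * (a1 t.1 * a t.1 - a0 t.1 ^+ 2) / dt t.
pose ga (t : R * R) :=
  b0 t.2 * b1 t.2 * (a1 t.1 * a t.1 - a0 t.1 ^+ 2) / dt t.
pose ep (t : R * R) :=
  a0 t.1 * a1 t.1 * (b1 t.2 * b t.2 - b0 t.2 ^+ 2) / dt t.
have C011 : christoffel g 0 1 1 = fun t => - l * al t.
  by apply/funext => s; case: (C s) => _ [].
have C111 : christoffel g 1 1 1 = fun t => n - l * be t.
  by apply/funext => s; case: (C s) => _ [].
have C001 : christoffel g 0 0 1 = ga.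
  by apply/funext => s; case: (C s) => -[].
have C101 : christoffel g 1 0 1 = ep.
  by apply/funext => s; case: (C s) => -[].
have [pa pa0 pa1] := da t.1; have [pb pb0 pb1] := db t.2.
set a' := 2 * a0 t.1 in pa.
set a0' := a1 t.1 + m * a0 t.1 - k * a t.1 in pa0.
set a1' := 2 * (m * a1 t.1 - k * a0 t.1) in pa1.
set b' := 2 * b0 t.2 in pb.
set b0' := b1 t.2 + n * b0 t.2 - l * b t.2 in pb0.
set b1' := 2 * (n * b1 t.2 - l * b0 t.2) in pb1.
have dtu : is_derive t.1 1 (fun s => dt (s, t.2))
  (a1' * b t.2 * (a t.1 * b1 t.2) + a1 t.1 * b t.2 * (a' * b1 t.2)
   - 2 * (a0 t.1 * b0 t.2) * (a0' * b0 t.2)).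
  rewrite /dt /=; apply: is_derive_fsub.
    by apply: is_derive_fmul; exact: is_derive_mulr.
  by apply: is_derive_fsqr; exact: is_derive_mulr.
have dtv : is_derive t.2 1 (fun s => dt (t.1, s))
  (a1 t.1 * b' * (a t.1 * b1 t.2) + a1 t.1 * b t.2 * (a t.1 * b1')
   - 2 * (a0 t.1 * b0 t.2) * (a0 t.1 * b0')).
  rewrite /dt /=; apply: is_derive_fsub.
    by apply: is_derive_fmul; exact: is_derive_mull.
  by apply: is_derive_fsqr; exact: is_derive_mull.
have dD : is_derive t.1 1 (fun s => a1 s * a s - a0 s ^+ 2)
    (a1' * a t.1 + a1 t.1 * a' - 2 * a0 t.1 * a0').
  by apply: is_derive_fsub; [exact: is_derive_fmul|exact: is_derive_fsqr].
have dE : is_derive t.2 1 (fun s => b1 s * b s - b0 s ^+ 2)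
    (b1' * b t.2 + b1 t.2 * b' - 2 * b0 t.2 * b0').
  by apply: is_derive_fsub; [exact: is_derive_fmul|exact: is_derive_fsqr].
have pal := is_derive_mull (- l) (is_derive_div
  (is_derive_mulr (b1 t.2 * b t.2 - b0 t.2 ^+ 2) (is_derive_fmul pa pa0)) dtu
  (dt0 (t.1, t.2))).
have pbe := is_derive_fsub (is_derive_const n t.1) (is_derive_mull l
  (is_derive_div (is_derive_mull (b t.2 * b0 t.2) dD) dtu (dt0 (t.1, t.2)))).
have pga := is_derive_div
  (is_derive_mulr (a1 t.1 * a t.1 - a0 t.1 ^+ 2) (is_derive_fmul pb0 pb1)) dtv
  (dt0 (t.1, t.2)).
have pep := is_derive_div (is_derive_mull (a0 t.1 * a1 t.1) dE) dtv
  (dt0 (t.1, t.2)).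
rewrite /gauss_curvature det_mx2 /riemann !big_ord_recl !big_ord0 !lift_ord0_I1.
rewrite C011 C111 C001 C101.
rewrite (@partial0_eq _ (fun t => - l * al t) _ _ pal).
rewrite (@partial0_eq _ (fun t => n - l * be t) _ _ pbe).
rewrite (@partial1_eq _ ga _ _ pga) (@partial1_eq _ ep _ _ pep).
have [[-> -> _ _] [-> -> _ _]] := C t.
have := dt0 t.
rewrite /al /be /ga /ep !mxE /a' /a0' /a1' /b' /b0' /b1' /=.
rewrite -(surjective_pairing t) /dt => dn0.
by field; exact: dn0.
Qed.

End CurvatureOfProductMetric.

(** * Tensor products of curves and their induced metric *)

Section TensorSurface.
Variable R : realType.

(** Stated for arbitrary curves so that a partial derivative is again a tensor surface, with one
    curve replaced by its derivative. *)
Definition tensor_surface (n1 n2 : nat) (c1 : R -> 'rV[R]_n1)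
    (c2 : R -> 'rV[R]_n2) (t : R * R) : 'rV[R]_(n1 * n2) :=
  mxvec ((c1 t.1)^T *m c2 t.2).

(** The pairing is u (w^T x) v^T, a product of the 1 by 1 matrices u w^T and x v^T. This is what
    separates the variables in the metric. *)
Lemma inner_mxvec (n1 n2 : nat) (u w : 'rV[R]_n1) (v x : 'rV[R]_n2) :
  inner (mxvec (u^T *m v)) (mxvec (w^T *m x)) = inner u w * inner v x.
Proof.
rewrite /inner mxvec_dotmul !mulmxA -mulmxA mxE big_ord1; congr (_ * _).
by rewrite -[in LHS](trmxK x) -trmx_mul mxE.
Qed.

Lemma derive1_mx (m n : nat) (M : R -> 'M[R]_(m, n)) (t : R)
    (d : 'M[R]_(m, n)) :
  (forall i j, is_derive t 1 (fun s => M s i j) (d i j)) ->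
  M^`()%classic t = d.
Proof.
move=> Md; have Mt : derivable M t 1.
  by apply/derivable_mxP => i j; case: (Md i j).
rewrite derive1E derive_mx//; apply/matrixP => i j; rewrite mxE.
by case: (Md i j).
Qed.

Lemma partial0_tensor_surface (n1 n2 : nat) (c1 d1 : R -> 'rV[R]_n1)
    (c2 : R -> 'rV[R]_n2) (t : R * R) :
  (forall (s : R) i, is_derive s 1 (fun s => c1 s 0 i) (d1 s 0 i)) ->
  partial 0 (tensor_surface c1 c2) t = tensor_surface d1 c2 t.
Proof.
move=> c1d; rewrite /partial eqxx; apply: derive1_mx => i j.
rewrite ord1; case/mxvec_indexP: j => j k; rewrite /tensor_surface mxvecE.
under eq_fun do rewrite mxvecE mxE big_ord1 mxE.
by rewrite mxE big_ord1 mxE /=; apply: is_derive_mulr.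
Qed.

Lemma partial1_tensor_surface (n1 n2 : nat) (c1 : R -> 'rV[R]_n1)
    (c2 d2 : R -> 'rV[R]_n2) (t : R * R) :
  (forall (s : R) i, is_derive s 1 (fun s => c2 s 0 i) (d2 s 0 i)) ->
  partial 1 (tensor_surface c1 c2) t = tensor_surface c1 d2 t.
Proof.
move=> c2d; rewrite /partial /=; apply: derive1_mx => i j.
rewrite ord1; case/mxvec_indexP: j => j k; rewrite /tensor_surface mxvecE.
under eq_fun do rewrite mxvecE mxE big_ord1 mxE.
by rewrite mxE big_ord1 mxE /=; apply: is_derive_mull.
Qed.

Lemma induced_metric_tensor_surface (n1 n2 : nat) (c1 d1 : R -> 'rV[R]_n1)
    (c2 d2 : R -> 'rV[R]_n2) :
  (forall (s : R) i, is_derive s 1 (fun s => c1 s 0 i) (d1 s 0 i)) ->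
  (forall (s : R) i, is_derive s 1 (fun s => c2 s 0 i) (d2 s 0 i)) ->
  induced_metric (tensor_surface c1 c2) =
  product_metric (fun s => inner (c1 s) (c1 s)) (fun s => inner (c1 s) (d1 s))
    (fun s => inner (d1 s) (d1 s)) (fun s => inner (c2 s) (c2 s))
    (fun s => inner (c2 s) (d2 s)) (fun s => inner (d2 s) (d2 s)).
Proof.
have innerC n (u v : 'rV[R]_n) : inner u v = inner v u.
  by rewrite /inner !mxE; apply: eq_bigr => i _; rewrite !mxE mulrC.
move=> c1d c2d; apply/funext => t; apply/matrixP => i j; rewrite !mxE.
have e i' : partial i' (tensor_surface c1 c2) t =
    if i' == 0 then tensor_surface d1 c2 t else tensor_surface c1 d2 t.
  case: (unliftP 0 i') => [k|] ->; last exact: partial0_tensor_surface.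
  by rewrite lift_ord0_I1; exact: partial1_tensor_surface.
rewrite !e; case: ifP => _; case: ifP => _; rewrite inner_mxvec //.
  by rewrite [inner (d1 _) _]innerC.
by rewrite [inner (d2 _) _]innerC.
Qed.

(** The inner product of the p-th and q-th derivatives of (e^(rt), e^(st)), which depends only on j
    = p + q. *)
Definition exp_gram (r s : R) (j : nat) (t : R) : R :=
  r ^+ j * expR (r * t) ^+ 2 + s ^+ j * expR (s * t) ^+ 2.

Lemma is_derive_expRM (r x : R) :
  is_derive x 1 (fun t => expR (r * t)) (r * expR (r * x)).
Proof.
have h : is_derive x 1 (fun t : R => r * t) (r * 1).
  exact: is_derive_mull.
apply: (is_derive_eq (is_derive1_comp (is_derive_expR (r * x)) h)).
by rewrite mulr1 mulrC.
Qed.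

(** Differentiation doubles and raises j by one; indices are lowered again because r and s are the
    roots of X^2 - (r + s) X + r s. *)
Lemma gram_system_exp (r s : R) :
  gram_system (r + s) (r * s)
    (exp_gram r s 0) (exp_gram r s 1) (exp_gram r s 2).
Proof.
have e j (x : R) : is_derive x 1 (exp_gram r s j)
    (2 * (r ^+ j.+1 * expR (r * x) ^+ 2 + s ^+ j.+1 * expR (s * x) ^+ 2)).
  have d q : is_derive x 1 (fun t => q ^+ j * expR (q * t) ^+ 2)
      (q ^+ j * (2 * expR (q * x) * (q * expR (q * x)))).
    by apply/is_derive_mull/is_derive_fsqr/is_derive_expRM.
  by apply: (is_derive_eq (is_derive_fadd (d r) (d s))); rewrite !exprS; ring.
move=> x; split; apply: (is_derive_eq (e _ _)); rewrite /exp_gram; ring.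
Qed.

End TensorSurface.

(** * The associated curve of an operator of order two *)

Section AssociatedCurve.
Variable R : realType.

Lemma root_enumeration_mem (n : nat) (c : 'rV[R]_n) (z : n.-tuple R[i])
    (r : R) :
  root_enumeration c z -> root (char_polynomial c) r ->
  real_complex R r \in (z : seq R[i]).
Proof.
move=> hz hr; rewrite -root_prod_XsubC -hz /complex_char_polynomial.
by rewrite fmorph_root.
Qed.

(** The two dominant roots have opposite signs, hence are distinct and exhaust a list of length two;
    only their order is left open. *)
Lemma associated_curve_order2 (c : 'rV[R]_2) (z : 2.-tuple R[i]) :
  root_enumeration c z -> real_roots_dominant c ->
  exists r s : R, [/\ 0 < r, s < 0 &
    associated_curve z =
      (fun t => \row_i expR ((if i == 0 then r else s) * t)) \/
    associated_curve z =
      (fun t => \row_i expR ((if i == 0 then s else r) * t))].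
Proof.
move=> hz [[r [r0 hr _]] [s [s0 hs _]]]; exists r, s; split => //.
have rs : real_complex R r != real_complex R s.
  by rewrite (inj_eq (fmorph_inj (real_complex R))) gt_eqF// (lt_trans s0).
have := root_enumeration_mem hz hs; have := root_enumeration_mem hz hr.
(* For a real root the cosine is cos 0 = 1, and since the roots differ there is no earlier
   occurrence, so the power of t is t^0. *)
have curveE (p q : R) : p != q ->
    z = [tuple real_complex R p; real_complex R q] ->
    associated_curve z = fun t => \row_i expR ((if i == 0 then p else q) * t).
  move=> pq ->; apply/funext => t; apply/rowP => i; rewrite !mxE.
  case: (unliftP 0 i) => [k|] ->; last first.
    by rewrite !(tnth_nth 0) /= lexx mul0r cos0 expr0 mul1r mulr1.
  rewrite !(tnth_nth 0) ord1 /= lexx mul0r cos0 mulr1.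
  rewrite (inj_eq (fmorph_inj (real_complex R))) (negPf pq) expr0.
  by rewrite mul1r.
case: z hz curveE => -[|x [|y []]]// sz hz curveE.
rewrite !inE => /orP[] /eqP xr /orP[] /eqP ys; subst.
- by rewrite -ys eqxx in rs.
- left; apply: curveE; last exact/val_inj.
  by rewrite gt_eqF// (lt_trans s0).
- right; apply: curveE; last exact/val_inj.
  by rewrite lt_eqF// (lt_trans s0).
- by rewrite -ys eqxx in rs.
Qed.

(** Swapping the two coordinates changes no inner product, so the order of the roots disappears
    here. *)
Lemma associated_curve_gram (c : 'rV[R]_2) (z : 2.-tuple R[i]) :
  root_enumeration c z -> real_roots_dominant c ->
  exists (r s : R) (d : R -> 'rV[R]_2),
  [/\ 0 < r, s < 0, forall (t : R) i,
      is_derive t 1 (fun t => associated_curve z t 0 i) (d t 0 i) &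
    [/\ forall t, inner (associated_curve z t) (associated_curve z t) =
          exp_gram r s 0 t,
        forall t, inner (associated_curve z t) (d t) = exp_gram r s 1 t &
        forall t, inner (d t) (d t) = exp_gram r s 2 t]].
Proof.
move=> hz hd; have [r [s [r0 s0 zE]]] := associated_curve_order2 hz hd.
have curve (p q : R) (sigma : R -> 'rV[R]_2) :
    sigma = (fun t => \row_i expR ((if i == 0 then p else q) * t)) ->
    exists d : R -> 'rV[R]_2,
      (forall (t : R) i, is_derive t 1 (fun t => sigma t 0 i) (d t 0 i)) /\
      [/\ forall t, inner (sigma t) (sigma t) = exp_gram p q 0 t,
          forall t, inner (sigma t) (d t) = exp_gram p q 1 t &
          forall t, inner (d t) (d t) = exp_gram p q 2 t].
  move=> ->; pose w (i : 'I_2) := if i == 0 then p else q.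
  exists (fun t => \row_i (w i * expR (w i * t))); split.
    move=> t i; rewrite mxE; under eq_fun do rewrite mxE.
    exact: is_derive_expRM.
  by split=> t; rewrite /inner mxE !big_ord_recl big_ord0 !mxE lift_ord0_I1
    /w /= /exp_gram; ring.
have gramC j t : exp_gram s r j t = exp_gram r s j t by rewrite /exp_gram addrC.
case: zE => /curve[d [dd [g0 g1 g2]]]; exists r, s, d; split=> //.
by split=> t; rewrite ?g0 ?g1 ?g2 gramC.
Qed.

End AssociatedCurve.

(** * Explicit formula for the curvature density *)

Section CurvatureDensity.
Variable R : realType.

(* For x = e^((a + b) u) and y = e^((c + d) v), [det_factor] is det g divided by
   e^((a - b) u + (c - d) v) squared, and [density] is K sqrt(det g). *)
Definition det_factor (a b c d x y : R) : R :=
  (a * x - b / x) ^+ 2 * (c + d) ^+ 2 + (a + b) ^+ 2 * (c * y - d / y) ^+ 2 +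
  (a + b) ^+ 2 * (c + d) ^+ 2.

(** The factor k l p_0 q_0 - p_2 q_2 for k = -a b and l = -c d, after division by the common
    exponentials. *)
Definition density_numerator (a b c d x y : R) : R :=
  a * b * (c * d) * (x + x^-1) * (y + y^-1) -
  (a ^+ 2 * x + b ^+ 2 / x) * (c ^+ 2 * y + d ^+ 2 / y).

Definition density (a b c d x y : R) : R :=
  (a + b) ^+ 2 * (c + d) ^+ 2 * density_numerator a b c d x y *
  Num.sqrt (det_factor a b c d x y) / det_factor a b c d x y ^+ 2.

Lemma det_factor_gt0 (a b c d x y : R) : 0 < a -> 0 < b -> 0 < c -> 0 < d ->
  0 < det_factor a b c d x y.
Proof.
move=> a0 b0 c0 d0; rewrite /det_factor ltr_wpDl//; last first.
  by rewrite mulr_gt0// exprn_gt0// addr_gt0.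
by rewrite addr_ge0// mulr_ge0// sqr_ge0.
Qed.

(** Dividing e^(2at) and e^(-2bt) by their geometric mean [q] leaves x and 1/x. *)
Lemma exp_gramE (a b t : R) (x := expR ((a + b) * t))
    (q := expR (a * t) * expR (- b * t)) :
  [/\ exp_gram a (- b) 0 t = q * (x + x^-1),
      exp_gram a (- b) 1 t = q * (a * x - b / x) &
      exp_gram a (- b) 2 t = q * (a ^+ 2 * x + b ^+ 2 / x)].
Proof.
have xE : x = expR (a * t) * (expR (- b * t))^-1.
  by rewrite -expRN -expRD /x; congr expR; ring.
have ea : expR (a * t) != 0 by rewrite gt_eqF// expR_gt0.
have eb : expR (- b * t) != 0 by rewrite gt_eqF// expR_gt0.
rewrite /exp_gram /q xE; split; field; exact/andP.
Qed.

(** After division by the exponentials, D and E become the constants (a + b)^2 and (c + d)^2. The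
    remaining powers of the exponential factor cancel between K and sqrt(det g). *)
Lemma curvature_density_order2 (c1 c2 : 'rV[R]_2) (z1 z2 : 2.-tuple R[i]) :
  root_enumeration c1 z1 -> root_enumeration c2 z2 ->
  real_roots_dominant c1 -> real_roots_dominant c2 ->
  exists a b c d : R, [/\ 0 < a, 0 < b, 0 < c, 0 < d &
    curvature_density (associated_surface z1 z2) =
    fun t => density a b c d (expR ((a + b) * t.1)) (expR ((c + d) * t.2))].
Proof.
move=> h1 h2 hd1 hd2.
have [a [b' [d1 [a0 b'0 dd1 [g10 g11 g12]]]]] := associated_curve_gram h1 hd1.
have [c [d' [d2 [c0 d'0 dd2 [g20 g21 g22]]]]] := associated_curve_gram h2 hd2.
pose b := - b'; pose d := - d'; exists a, b, c, d.
have b0 : 0 < b by rewrite oppr_gt0.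
have d0 : 0 < d by rewrite oppr_gt0.
split=> //; apply/funext => t.
have -> : associated_surface z1 z2 =
  tensor_surface (associated_curve z1) (associated_curve z2) by [].
rewrite /curvature_density (induced_metric_tensor_surface dd1 dd2).
rewrite (funext g10) (funext g11) (funext g12).
rewrite (funext g20) (funext g21) (funext g22).
have -> : b' = - b by rewrite opprK.
have -> : d' = - d by rewrite opprK.
(* The common exponential factor of both curves: det g = q^2 W. *)
pose q (t : R * R) := expR (a * t.1) * expR (- b * t.1) *
  (expR (c * t.2) * expR (- d * t.2)).
have q0 t' : 0 < q t' by rewrite !mulr_gt0// expR_gt0.
pose W (t : R * R) :=
  det_factor a b c d (expR ((a + b) * t.1)) (expR ((c + d) * t.2)).
have W0 t' : 0 < W t' by exact: det_factor_gt0.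
have dtE t' : exp_gram a (- b) 2 t'.1 * exp_gram c (- d) 0 t'.2 *
    (exp_gram a (- b) 0 t'.1 * exp_gram c (- d) 2 t'.2) -
    (exp_gram a (- b) 1 t'.1 * exp_gram c (- d) 1 t'.2) ^+ 2 =
    q t' ^+ 2 * W t'.
  have [-> -> ->] := exp_gramE a b t'.1.
  have [-> -> ->] := exp_gramE c d t'.2.
  have x0 : expR ((a + b) * t'.1) != 0 by rewrite gt_eqF// expR_gt0.
  have y0 : expR ((c + d) * t'.2) != 0 by rewrite gt_eqF// expR_gt0.
  by rewrite /q /W /det_factor; field; apply/andP.
have dt0 t' : exp_gram a (- b) 2 t'.1 * exp_gram c (- d) 0 t'.2 *
    (exp_gram a (- b) 0 t'.1 * exp_gram c (- d) 2 t'.2) -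
    (exp_gram a (- b) 1 t'.1 * exp_gram c (- d) 1 t'.2) ^+ 2 != 0.
  by rewrite dtE gt_eqF// mulr_gt0// exprn_gt0.
rewrite (gauss_curvature_product (gram_system_exp _ _) (gram_system_exp _ _)
  dt0).
rewrite /area_density !mxE /= dtE sqrtrM ?sqr_ge0// sqrtr_sqr gtr0_norm//.
rewrite /density -/(W t).
have [-> -> ->] := exp_gramE a b t.1.
have [-> -> ->] := exp_gramE c d t.2.
have x0 : expR ((a + b) * t.1) != 0 by rewrite gt_eqF// expR_gt0.
have y0 : expR ((c + d) * t.2) != 0 by rewrite gt_eqF// expR_gt0.
have ea : expR (a * t.1) != 0 by rewrite gt_eqF// expR_gt0.
have eb : expR (- b * t.1) != 0 by rewrite gt_eqF// expR_gt0.
have ec : expR (c * t.2) != 0 by rewrite gt_eqF// expR_gt0.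
have ed : expR (- d * t.2) != 0 by rewrite gt_eqF// expR_gt0.
have Wn0 : W t != 0 by rewrite gt_eqF.
rewrite /density_numerator /q; field; by rewrite Wn0 x0 y0 ea eb ec ed.
Qed.

End CurvatureDensity.

(** * Point reflections of the plane and odd integrands *)

Section PlaneReflection.
Local Open Scope classical_set_scope.
Variable R : realType.
Local Notation mu := (@lebesgue_measure R).

Lemma measurable_reflection (c : R) :
  measurable_fun [set: measurableTypeR R] (fun x => c - x : measurableTypeR R).
Proof. exact: measurable_funB. Qed.

(** Lebesgue measure is determined by half-open intervals; a reflection moves the closed end to the
    other side but keeps the length. *)
Lemma lebesgue_measure_reflection (c : R) (A : set (measurableTypeR R)) :
  measurable A ->
  pushforward mu (fun x => c - x : measurableTypeR R) A = mu A.
Proof.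
move=> mA; apply/esym/lebesgue_measure_unique => //=.
  exact: measurable_reflection.
move=> _ _ [[a b]] _ <-; rewrite /pushforward.
have -> : (fun x => c - x) @^-1` `]a, b]%classic = `[c - b, c - a[%classic.
  by apply/seteqP; split => x /=; rewrite !in_itv/= => /andP[? ?];
    apply/andP; split; lra.
rewrite !lebesgue_measure_itv/= !lte_fin.
have -> : (c - b < c - a) = (a < b) by apply/idP/idP => ?; lra.
by case: ifP => // _; congr EFin; ring.
Qed.

Definition plane_reflection (p t : R * R) : R * R := (p.1 - t.1, p.2 - t.2).

Lemma measurable_plane_reflection (p : R * R) :
  measurable_fun [set: measurableTypeR R * measurableTypeR R]
    (plane_reflection p :
      _ -> (measurableTypeR R * measurableTypeR R)%type).
Proof. by apply/measurable_fun_pair; apply: measurable_funB. Qed.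

(** A product measure is determined by its values on rectangles, and the preimage of a rectangle is
    the rectangle of the reflected sides. *)
Lemma plane_measure_reflection (p : R * R)
    (A : set (measurableTypeR R * measurableTypeR R)) : measurable A ->
  pushforward (plane_measure R) (plane_reflection p :
      _ -> (measurableTypeR R * measurableTypeR R)%type) A = plane_measure R A.
Proof.
move=> mA; apply/esym/product_measure_unique => //=.
  exact: measurable_plane_reflection.
move=> _ X Y mX mY; rewrite /pushforward.
rewrite (_ : _ @^-1` _ = ((fun x => p.1 - x) @^-1` X) `*`
  ((fun x => p.2 - x) @^-1` Y))//.
rewrite product_measure1E.
- by congr (_ * _)%E; exact: lebesgue_measure_reflection.
- by rewrite -[X in measurable X]setTI; exact: measurable_reflection.
- by rewrite -[X in measurable X]setTI; exact: measurable_reflection.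
Qed.

(** The change of variables gives I = -I for the integral I, which is finite by integrability. *)
Lemma integral_plane_odd (p : R * R) (f : R * R -> R) :
  (plane_measure R).-integrable [set: R * R] (EFin \o f) ->
  (forall t, f (plane_reflection p t) = - f t) ->
  (\int[plane_measure R]_(t in [set: R * R]) (f t)%:E = 0)%E.
Proof.
move=> intf fodd.
have fN : (fun t => - (f t)%:E)%E =
    (EFin \o f) \o plane_reflection p.
  by apply/funext => t /=; rewrite fodd.
set I := (X in X = _); suff : (I = - I)%E.
  have : I \is a fin_num by exact: integrable_fin_num.
  move=> /fineK <-; rewrite -EFinN => -[] h; congr EFin; lra.
rewrite {2}/I -integralN; last exact: integrable_add_def.
have mp := measurable_plane_reflection p.
have intfN : (plane_measure R).-integrable [set: R * R]
    ((EFin \o f) \o plane_reflection p).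
  by rewrite -fN; exact: integrableN.
rewrite fN.
(* The right-hand side becomes the integral of [f] against the pushforward, a measure that agrees
   with [plane_measure] on measurable sets. *)
have <- := integral_pushforward mp (measurable_int _ intf) intfN measurableT.
by apply: eq_measure_integral => A mA _; exact/esym/plane_measure_reflection.
Qed.

End PlaneReflection.

(** * An integrable majorant on the plane *)

Section Majorants.
Variable R : realType.

(** The left side is a square because the density decays like the inverse square root of (x + 1/x)
    (y + 1/y); the root then supplies the factor 1 + u^2. *)
Lemma expR_addV_ge (k u : R) : 0 < k ->
  (Num.min 1 (k ^+ 2 / 16) * (1 + u ^+ 2)) ^+ 2 <=
  expR (k * u) + (expR (k * u))^-1.
Proof.
move=> k0.
(* With w = z/4, e^z = (e^w)^4 >= (1 + w)^4 >= (1 + w^2)^2; for z = k u this is the origin of k^2 /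
   16. *)
have e (z : R) : 0 <= z -> (1 + (z / 4) ^+ 2) ^+ 2 <= expR z.
  move=> z0; rewrite [z in leRHS](_ : _ = 4%:R * (z / 4)); last by field.
  rewrite expRM_natl; have := expR_ge1Dx (z / 4); set w := z / 4 => we.
  have w0 : 0 <= w by rewrite divr_ge0.
  apply: (@le_trans _ _ ((1 + w) ^+ 4)); last first.
    by rewrite ler_pXn2r ?nnegrE ?expR_ge0// addr_ge0.
  rewrite (_ : (1 + w) ^+ 4 = ((1 + w) ^+ 2) ^+ 2); last by ring.
  by rewrite ler_sqr ?nnegrE ?addr_ge0 ?sqr_ge0//; nra.
have e2 (z : R) : (1 + (z / 4) ^+ 2) ^+ 2 <= expR z + (expR z)^-1.
  have [z0|z0] := leP 0 z.
    by apply: (le_trans (e _ z0)); rewrite lerDl invr_ge0 expR_ge0.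
  rewrite -expRN; apply: (@le_trans _ _ (expR (- z))); last first.
    by rewrite lerDr expR_ge0.
  by have := e (- z); rewrite mulNr sqrrN; apply; rewrite oppr_ge0 ltW.
apply: le_trans (e2 _).
have m1 : Num.min 1 (k ^+ 2 / 16) <= 1 by rewrite ge_min lexx.
have m2 : Num.min 1 (k ^+ 2 / 16) <= k ^+ 2 / 16 by rewrite ge_min lexx orbT.
have m0 : 0 <= Num.min 1 (k ^+ 2 / 16).
  by rewrite le_min ler01 divr_ge0// sqr_ge0.
have u0 := sqr_ge0 u.
rewrite ler_sqr ?nnegrE ?mulr_ge0 ?addr_ge0 ?sqr_ge0//.
rewrite mulrDr mulr1 lerD//.
rewrite (_ : (k * u / 4) ^+ 2 = k ^+ 2 / 16 * u ^+ 2); last by field.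
exact: ler_wpM2r.
Qed.

Lemma integral_oneDsqrV :
  (\int[@lebesgue_measure R]_x (oneDsqr x)^-1%:E = pi%:E)%E.
Proof.
rewrite (@ge0_symfun_integralT _ (fun x => (oneDsqr x)^-1)).
- rewrite (_ : [set x : R | 0 <= x] = `[0, +oo[)%classic.
    by rewrite integral0y_oneDsqr -EFinM mulrCA divff// mulr1.
  by apply/seteqP; split => x /=; rewrite in_itv/= andbT.
- by move=> x; rewrite invr_ge0.
- exact: continuous_oneDsqrV.
- by move=> x /=; rewrite /oneDsqr sqrrN.
Qed.

(** By Tonelli the integral is pi^2. *)
Lemma integrable_oneDsqrV2 : (plane_measure R).-integrable [set: R * R]
  (fun t => ((oneDsqr t.1)^-1 * (oneDsqr t.2)^-1)%:E).
Proof.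
have h0 x : 0 <= (oneDsqr x)^-1 :> R by rewrite invr_ge0.
have mh : measurable_fun [set: measurableTypeR R]
    (fun x => (oneDsqr x)^-1 : R).
  by apply: continuous_measurable_fun; exact: continuous_oneDsqrV.
have mf : measurable_fun [set: measurableTypeR R * measurableTypeR R]
    (fun t => ((oneDsqr t.1)^-1 * (oneDsqr t.2)^-1)%:E).
  by apply/measurable_EFinP; apply: measurable_funM;
    exact: (measurableT_comp mh).
apply/integrableP; split => //.
under eq_integral => t _ do rewrite gee0_abs ?lee_fin ?mulr_ge0//.
rewrite /plane_measure fubini_tonelli1//.
rewrite /fubini_F /=.
under eq_integral => x _.
  under eq_integral => y _ do rewrite EFinM.
  rewrite ge0_integralZl ?lee_fin//; last exact/measurable_EFinP.
  rewrite integral_oneDsqrV.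
  over.
rewrite /= ge0_integralZr ?lee_fin ?pi_ge0//; last exact/measurable_EFinP.
by rewrite integral_oneDsqrV -EFinM ltry.
Qed.

End Majorants.

(** * Oddness, decay and integrability of the density *)

Section DensityEstimates.
Variable R : realType.
Variables a b c d : R.
Hypotheses (a0 : 0 < a) (b0 : 0 < b) (c0 : 0 < c) (d0 : 0 < d).

(** In each variable a b (x + 1/x) and a^2 x + b^2/x trade places, which exchanges the two terms of
    [density_numerator]. The differences a x - b/x and c y - d/y change sign, but [det_factor]
    contains only their squares. *)
Lemma density_inv (x y : R) : 0 < x -> 0 < y ->
  density a b c d (b / a / x) (d / c / y) = - density a b c d x y.
Proof.
move=> x0 y0.
have [an bn cn dn] : [/\ a != 0, b != 0, c != 0 & d != 0].
  by split; rewrite gt_eqF.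
have [xn yn] : x != 0 /\ y != 0 by split; rewrite gt_eqF.
have WE : det_factor a b c d (b / a / x) (d / c / y) = det_factor a b c d x y.
  by rewrite /det_factor; field; rewrite an bn cn dn xn yn.
have NE : density_numerator a b c d (b / a / x) (d / c / y) =
    - density_numerator a b c d x y.
  by rewrite /density_numerator; field; rewrite an bn cn dn xn yn.
by rewrite /density WE NE; ring.
Qed.

(* Half of this point is the fixed point of the reflection
   (x, y) -> (b/(a x), d/(c y)) in the coordinates (u, v). *)
Definition density_center : R * R :=
  (ln (b / a) / (a + b), ln (d / c) / (c + d)).

Lemma density_odd (t : R * R) :
  let f t := density a b c d (expR ((a + b) * t.1)) (expR ((c + d) * t.2)) in
  f (plane_reflection density_center t) = - f t.
Proof.
move=> f; rewrite /f -density_inv ?expR_gt0//.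
have e (p q u : R) : 0 < p -> 0 < q ->
    expR ((p + q) * (ln (q / p) / (p + q) - u)) = q / p / expR ((p + q) * u).
  move=> p0 q0; rewrite mulrBr mulrCA divff ?mulr1 ?gt_eqF ?addr_gt0//.
  by rewrite expRD expRN lnK// posrE divr_gt0.
by rewrite /= !e.
Qed.

(* [det_factor] is (a + b)^2 (c + d)^2 (1 + P^2 + Q^2) with
   P = (a x - b/x) / (a + b) and Q = (c y - d/y) / (c + d); the bound comes from
   (1 + P^2 + Q^2)^2 >= (1 + P^2) (1 + Q^2). *)
Lemma det_factor_ge (x y : R) : 0 < x -> 0 < y ->
  (a + b) * (c + d) * (Num.min a b * Num.min c d) *
    ((x + x^-1) * (y + y^-1)) <= det_factor a b c d x y.
Proof.
move=> x0 y0.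
have e (p q z : R) : 0 < p -> 0 < q -> 0 < z ->
    (Num.min p q * (z + z^-1)) ^+ 2 <= (p * z - q / z) ^+ 2 + (p + q) ^+ 2.
  move=> p0 q0 z0.
  (* The cross terms -2pq and 2pq cancel, so p and q can be bounded below separately by their
     minimum. *)
  have -> : (p * z - q / z) ^+ 2 + (p + q) ^+ 2 =
      p ^+ 2 * (z ^+ 2 + 1) + q ^+ 2 * (1 + z^-1 ^+ 2).
    by field; rewrite gt_eqF.
  have -> : (Num.min p q * (z + z^-1)) ^+ 2 =
      Num.min p q ^+ 2 * (z ^+ 2 + 1) + Num.min p q ^+ 2 * (1 + z^-1 ^+ 2).
    by field; rewrite gt_eqF.
  have m0 : 0 <= Num.min p q by rewrite le_min !ltW.
  apply: lerD; (apply: ler_wpM2r; first by rewrite addr_ge0// sqr_ge0);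
    by rewrite ler_sqr ?nnegrE ?(ltW p0) ?(ltW q0)// ge_min lexx ?orbT.
have ex := e _ _ _ a0 b0 x0; have ey := e _ _ _ c0 d0 y0.
have ab : 0 < a + b by rewrite addr_gt0.
have cd : 0 < c + d by rewrite addr_gt0.
rewrite -(@ler_pXn2r _ 2)// ?nnegrE; last 2 first.
- by rewrite !mulr_ge0 ?addr_ge0 ?invr_ge0 ?le_min ?ltW.
- exact/ltW/det_factor_gt0.
set p := (a * x - b / x) ^+ 2 in ex; set q := (c * y - d / y) ^+ 2 in ey.
apply: (@le_trans _ _ ((a + b) ^+ 2 * (c + d) ^+ 2 *
   ((p + (a + b) ^+ 2) * (q + (c + d) ^+ 2)))).
  set X := x + _; set Y := y + _.
  rewrite [leLHS](_ : _ = (a + b) ^+ 2 * (c + d) ^+ 2 *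
    ((Num.min a b * X) ^+ 2 * (Num.min c d * Y) ^+ 2)); last by ring.
  apply: ler_wpM2l; first by rewrite mulr_ge0// sqr_ge0.
  by apply: ler_pM => //; exact: sqr_ge0.
rewrite /det_factor -/p -/q.
have p0 : 0 <= p by exact: sqr_ge0.
have q0 : 0 <= q by exact: sqr_ge0.
rewrite -subr_ge0.
set s := (a + b) ^+ 2; set t := (c + d) ^+ 2.
have s0 : 0 <= s by exact: sqr_ge0.
have t0 : 0 <= t by exact: sqr_ge0.
(* The term s^2 t^2 cancels, and what remains of the difference has only nonnegative summands. *)
rewrite (_ : _ - _ = (p * t) ^+ 2 + (s * q) ^+ 2 + p * q * s * t +
  p * s * t ^+ 2 + q * t * s ^+ 2); last by ring.
by clearbody p q s t; rewrite ?(addr_ge0, mulr_ge0, sqr_ge0).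
Qed.

Lemma density_numerator_le (x y : R) : 0 < x -> 0 < y ->
  `|density_numerator a b c d x y| <=
  (a * b * (c * d) + (a ^+ 2 + b ^+ 2) * (c ^+ 2 + d ^+ 2)) *
    ((x + x^-1) * (y + y^-1)).
Proof.
move=> x0 y0.
have xV0 : 0 < x^-1 by rewrite invr_gt0.
have yV0 : 0 < y^-1 by rewrite invr_gt0.
have h (p q z w : R) : 0 <= p -> 0 <= q -> 0 < z -> 0 < w ->
    0 <= p * z + q * w <= (p + q) * (z + w) by move=> *; apply/andP; split; nra.
have /andP[u0 u1] := h _ _ _ _ (sqr_ge0 a) (sqr_ge0 b) x0 xV0.
have /andP[v0 v1] := h _ _ _ _ (sqr_ge0 c) (sqr_ge0 d) y0 yV0.
rewrite /density_numerator; apply: le_trans (ler_normB _ _) _.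
rewrite -mulrA ger0_norm; last first.
  by rewrite ?(mulr_ge0, addr_ge0)//; exact: ltW.
rewrite ger0_norm; last exact: mulr_ge0.
by rewrite [leRHS]mulrDl lerD2l [leRHS]mulrACA ler_pM.
Qed.

(** Up to a constant the density is N W^(-3/2). Since |N| is at most a multiple of (x + 1/x) (y +
    1/y), hence of W, only W^(-1/2) has to be estimated. *)
Lemma density_le : exists C : R, forall t : R * R,
  `|density a b c d (expR ((a + b) * t.1)) (expR ((c + d) * t.2))| <=
  C * ((oneDsqr t.1)^-1 * (oneDsqr t.2)^-1).
Proof.
have ab : 0 < a + b by rewrite addr_gt0.
have cd : 0 < c + d by rewrite addr_gt0.
pose K := (a + b) * (c + d) * (Num.min a b * Num.min c d).
have K0 : 0 < K by rewrite ?mulr_gt0// lt_min ?a0 ?c0.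
pose M := a * b * (c * d) + (a ^+ 2 + b ^+ 2) * (c ^+ 2 + d ^+ 2).
have M0 : 0 <= M.
  by rewrite /M ?(addr_ge0, mulr_ge0, sqr_ge0)//; exact: ltW.
pose m1 := Num.min 1 ((a + b) ^+ 2 / 16).
pose m2 := Num.min 1 ((c + d) ^+ 2 / 16).
have m10 : 0 < m1 by rewrite lt_min ltr01 divr_gt0// exprn_gt0.
have m20 : 0 < m2 by rewrite lt_min ltr01 divr_gt0// exprn_gt0.
(* M / K comes from |N| <= (M / K) W, and the denominator from sqrt W >= sqrt K m1 m2 (1 + u^2) (1 +
   v^2). *)
exists ((a + b) ^+ 2 * (c + d) ^+ 2 * (M / K) / (Num.sqrt K * (m1 * m2))) => t.
set x := expR _; set y := expR _.
have x0 : 0 < x by exact: expR_gt0.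
have y0 : 0 < y by exact: expR_gt0.
have W0 := det_factor_gt0 x y a0 b0 c0 d0.
have KW := det_factor_ge x0 y0; rewrite -/K in KW.
have NM := density_numerator_le x0 y0; rewrite -/M in NM.
have gX := expR_addV_ge t.1 ab; rewrite -/x -/m1 in gX.
have gY := expR_addV_ge t.2 cd; rewrite -/y -/m2 in gY.
rewrite /density; set W := det_factor _ _ _ _ _ _ in W0 KW *.
set N := density_numerator _ _ _ _ _ _ in NM *.
set X := x + _ in KW NM gX; set Y := y + _ in KW NM gY.
pose s := Num.sqrt W; have s0 : 0 < s by rewrite sqrtr_gt0.
have Ws : W = s ^+ 2 by rewrite sqr_sqrtr// ltW.
have NW : `|N| <= M / K * s ^+ 2.
  rewrite -Ws; apply: le_trans NM _.
  by rewrite -[leRHS]mulrA ler_wpM2l// [leRHS]mulrC ler_pdivlMr// mulrC.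
have o1 : 0 < oneDsqr t.1 by exact: lt_le_trans ltr01 (oneDsqr_ge1 _).
have o2 : 0 < oneDsqr t.2 by exact: lt_le_trans ltr01 (oneDsqr_ge1 _).
have sK : Num.sqrt K * (m1 * m2) * (oneDsqr t.1 * oneDsqr t.2) <= s.
  rewrite -ler_sqr ?nnegrE ?(ltW s0)//; last first.
    by rewrite ?(mulr_ge0, sqrtr_ge0)//; exact: ltW.
  rewrite -Ws; apply: le_trans KW.
  rewrite [leLHS](_ : _ = Num.sqrt K ^+ 2 *
    ((m1 * oneDsqr t.1) ^+ 2 * (m2 * oneDsqr t.2) ^+ 2)); last by ring.
  rewrite sqr_sqrtr ?(ltW K0)// ler_wpM2l ?(ltW K0)//.
  by apply: ler_pM => //; exact: sqr_ge0.
have A0 : 0 <= (a + b) ^+ 2 * (c + d) ^+ 2 by rewrite mulr_ge0// sqr_ge0.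
rewrite -/s Ws normrM normrM normrM (ger0_norm A0) (gtr0_norm s0).
rewrite [`|_ ^-1|]ger0_norm ?invr_ge0 ?sqr_ge0//.
apply: (@le_trans _ _ ((a + b) ^+ 2 * (c + d) ^+ 2 * (M / K) / s)).
  rewrite [leRHS](_ : _ =
    (a + b) ^+ 2 * (c + d) ^+ 2 * (M / K * s ^+ 2) * s / (s ^+ 2) ^+ 2).
    rewrite ler_wpM2r ?invr_ge0 ?sqr_ge0// ler_wpM2r ?(ltW s0)//.
    exact: ler_wpM2l.
  by field; rewrite !gt_eqF.
rewrite -[leRHS]mulrA ler_wpM2l//.
  by rewrite (mulr_ge0 A0)// divr_ge0// ltW.
rewrite -!invfM lef_pV2//.
by rewrite posrE ?mulr_gt0// sqrtr_gt0.
Qed.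

Lemma measurable_density :
  measurable_fun [set: measurableTypeR R * measurableTypeR R]
  (fun t => density a b c d (expR ((a + b) * t.1)) (expR ((c + d) * t.2))).
Proof.
(* For a positive function the inverse is the real power with exponent -1, which is measurable. *)
have mV (f : measurableTypeR R * measurableTypeR R -> R) :
    measurable_fun setT f -> (forall t, 0 < f t) ->
    measurable_fun setT (fun t => (f t)^-1).
  move=> mf f0; under eq_fun do rewrite -powR_inv1 ?(ltW (f0 _))//.
  exact: (measurableT_comp (measurable_powR (-1))).
have mx : measurable_fun [set: measurableTypeR R * measurableTypeR R]
    (fun t => expR ((a + b) * t.1) : R).
  by apply: measurableT_comp => //; exact: measurable_funM.
have my : measurable_fun [set: measurableTypeR R * measurableTypeR R]
    (fun t => expR ((c + d) * t.2) : R).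
  by apply: measurableT_comp => //; exact: measurable_funM.
have mxV := mV _ mx (fun=> expR_gt0 _); have myV := mV _ my (fun=> expR_gt0 _).
have mW : measurable_fun [set: measurableTypeR R * measurableTypeR R]
    (fun t => det_factor a b c d (expR ((a + b) * t.1)) (expR ((c + d) * t.2))).
  apply: measurable_funD => //; apply: measurable_funD;
  apply: measurable_funM => //; apply: measurable_funX;
  by apply: measurable_funB; apply: measurable_funM.
have mWV := mV _ mW (fun=> det_factor_gt0 _ _ a0 b0 c0 d0).
rewrite /density; under eq_fun do rewrite -exprVn.
apply: measurable_funM; last exact: measurable_funX.
apply: measurable_funM; last first.
  apply: measurableT_comp => //; apply: continuous_measurable_fun.
  exact: sqrt_continuous.
apply: measurable_funM => //; apply: measurable_funB; apply: measurable_funM.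
- by apply: measurable_funM => //; exact: measurable_funD.
- exact: measurable_funD.
- by apply: measurable_funD; exact: measurable_funM.
- by apply: measurable_funD; exact: measurable_funM.
Qed.

Lemma integrable_density : (plane_measure R).-integrable [set: R * R]
  (fun t =>
    (density a b c d (expR ((a + b) * t.1)) (expR ((c + d) * t.2)))%:E).
Proof.
have [C le_C] := density_le.
have int_majorant := integrableZl measurableT C (integrable_oneDsqrV2 R).
apply: le_integrable int_majorant => //.
  by apply/measurable_EFinP; exact: measurable_density.
by move=> t _; rewrite /= lee_fin (le_trans (le_C t))// ler_norm.
Qed.

End DensityEstimates.

Theorem theorem1p12 (R : realType) (n1 n2 : nat)
    (c1 : 'rV[R]_n1) (c2 : 'rV[R]_n2)
    (z1 : n1.-tuple R[i]) (z2 : n2.-tuple R[i])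
    (hz1 : root_enumeration c1 z1) (hz2 : root_enumeration c2 z2)
    (simple1 : all_roots_simple c1) (simple2 : all_roots_simple c2)
    (dominant1 : real_roots_dominant c1) (dominant2 : real_roots_dominant c2)
    (hn1 : n1 = 2%N) (hn2 : n2 = 2%N) :
  (plane_measure R).-integrable [set: R * R]
    (fun t => (curvature_density (associated_surface z1 z2) t)%:E) /\
  total_gauss_curvature (associated_surface z1 z2) = 0%E.
Proof.
subst n1 n2; rewrite /total_gauss_curvature.
have [a [b [c [d [a0 b0 c0 d0 ->]]]]] :=
  curvature_density_order2 hz1 hz2 dominant1 dominant2.
(* Integrability is the first claim and also the hypothesis under which oddness makes the integral
   vanish. *)
have int_density := integrable_density a0 b0 c0 d0; split => //.
exact: (integral_plane_odd int_density (density_odd a0 b0 c0 d0)).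
Qed.
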